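(* Let $A,B\in\mathbb{R}^{m\times n}$ and $b\in\mathbb{R}^m$. Suppose that the solution set $\mathcal{X}^*=\{x\in\mathbb{R}^n : Ax-B|x|=b\}$ is non-empty and that for every $D\in[-I_n,I_n]$ the matrix $A+BD$ has full column rank. Then for every $x^*\in\mathcal{X}^*$ and every nonsingular matrix $M\in\mathbb{R}^{m\times m}$, $$\|x-x^*\|\le \max_{D\in[-I_n,I_n]}\big\|(MA+MBD)^{\dagger}\big\|\cdot\big\|M(Ax-B|x|-b)\big\|\qquad\text{for all }x\in\mathbb{R}^n,$$ where $\|\cdot\|$ represents any vector norm and its induced matrix norm.
   Context: For $x\in\mathbb{R}^n$, $|x|=(|x_1|,\ldots,|x_n|)^\top$ is the componentwise absolute value. $[-I_n,I_n]=\{D\in\mathbb{R}^{n\times n} : -I_n\le D\le I_n \text{ entrywise}\}$, i.e. the set of diagonal $n\times n$ matrices with diagonal entries in $[-1,1]$. $C^\dagger$ denotes the Moore–Penrose pseudoinverse of $C$. A vector norm $\|\cdot\|$ is used on $\mathbb{R}^n$ and on $\mathbb{R}^m$; for $C\in\mathbb{R}^{n\times m}$, $\|C\|=\sup_{y\neq 0}\|Cy\|/\|y\|$ is the induced norm. *)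

(* Defs.v *)
From mathcomp Require Export all_boot all_order all_algebra.
From mathcomp Require Export boolp classical_sets reals.

Set Implicit Arguments.
Unset Strict Implicit.
Unset Printing Implicit Defensive.

Import Order.TTheory GRing.Theory Num.Theory.

Local Open Scope classical_set_scope.
Local Open Scope ring_scope.

Section Definitions.
Variable R : realType.

(* Nonnegativity of N follows from these three axioms. *)
Definition vector_norm n (N : 'cV[R]_n -> R) : Prop :=
  [/\ forall x, N x = 0 -> x = 0,
      forall a x, N (a *: x) = `|a| * N x
    & forall x y, N (x + y) <= N x + N y].

(* For C mapping (R^m, Nm) to (R^n, Nn); sup set0 = 0 covers m = 0. *)
Definition induced_norm n m (Nn : 'cV[R]_n -> R) (Nm : 'cV[R]_m -> R)
    (C : 'M[R]_(n, m)) : R :=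
  sup [set Nn (C *m y) / Nm y | y in [set y : 'cV[R]_m | y != 0]].

Definition abs_mx m n (C : 'M[R]_(m, n)) : 'M[R]_(m, n) := map_mx Num.norm C.

(* Off-diagonal entries satisfy - 0 <= D i j <= 0, so D is diagonal. *)
Definition unit_box n : set 'M[R]_n :=
  [set D | forall i j, - (1%:M : 'M[R]_n) i j <= D i j <= (1%:M : 'M[R]_n) i j].

Definition gave_sol m n (A B : 'M[R]_(m, n)) (b : 'cV[R]_m) : set 'cV[R]_n :=
  [set x | A *m x - B *m abs_mx x = b].

Definition is_moore_penrose m n (C : 'M[R]_(m, n)) (P : 'M[R]_(n, m)) : Prop :=
  [/\ C *m P *m C = C, P *m C *m P = P,
      (C *m P)^T = C *m P & (P *m C)^T = P *m C].

(* Defined by choice; is_moore_penrose_mpinv and mpinv_unique show that it is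
   the one matrix satisfying the Penrose equations, for every C. *)
Definition mpinv m n (C : 'M[R]_(m, n)) : 'M[R]_(n, m) :=
  xget 0 [set P | is_moore_penrose C P].

Definition full_column_rank m n (C : 'M[R]_(m, n)) : Prop := \rank C = n.

Definition is_max (S : set R) (mu : R) : Prop := S mu /\ ubound S mu.

Lemma row_gram_eq0 n (w : 'rV[R]_n) : w *m w^T = 0 -> w = 0.
Proof.
move=> /matrixP/(_ 0 0); rewrite !mxE => ww0; apply/rowP => i; rewrite mxE.
have sq k : w 0 k * w^T k 0 = w 0 k ^+ 2 by rewrite mxE expr2.
rewrite (eq_bigr _ (fun k _ => sq k)) in ww0.
have w2 : w 0 i ^+ 2 = 0.
  by apply: (psumr_eq0P _ ww0) => // k _; exact: sqr_ge0.
by apply/eqP; rewrite -sqrf_eq0 w2.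
Qed.

Lemma row_gram_unit r n (G : 'M[R]_(r, n)) :
  row_free G -> G *m G^T \in unitmx.
Proof.
move=> fG; rewrite -row_free_unit -kermx_eq0; apply/rowV0P => v /sub_kermxP.
move=> vGG0; apply: (row_free_inj fG); rewrite mul0mx.
by apply: row_gram_eq0; rewrite trmx_mul mulmxA -(mulmxA v) vGG0 mul0mx.
Qed.

(* With the rank factorization C = F *m G, the pseudoinverse is
   G^T (G G^T)^-1 (F^T F)^-1 F^T. *)
Lemma moore_penrose_exists m n (C : 'M[R]_(m, n)) :
  exists P, is_moore_penrose C P.
Proof.
have uG := row_gram_unit (row_base_free C).
have uF : (col_base C)^T *m col_base C \in unitmx.
  have := @row_gram_unit _ _ (col_base C)^T; rewrite trmxK; apply.
  by rewrite /row_free mxrank_tr; exact: col_base_full.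
move: (col_base C) (row_base C) (esym (mulmx_base C)) uG uF.
move: (\rank C) => r F G CE uG uF.
set H := invmx (G *m G^T); set K := invmx (F^T *m F).
have GH : G *m (G^T *m H) = 1%:M by rewrite mulmxA mulmxV.
have KF : K *m F^T *m F = 1%:M by rewrite -mulmxA mulVmx.
pose P := (G^T *m H) *m (K *m F^T).
have CP : C *m P = F *m (K *m F^T).
  by rewrite CE /P -(mulmxA F) (mulmxA G) GH mul1mx.
have PC : P *m C = G^T *m H *m G.
  by rewrite CE /P -(mulmxA (G^T *m H)) (mulmxA _ F) KF mul1mx.
have HT : H^T = H by rewrite /H trmx_inv trmx_mul trmxK.
have KT : K^T = K by rewrite /K trmx_inv trmx_mul trmxK.
exists P; split.
- by rewrite CP CE -(mulmxA F) (mulmxA _ F) KF mul1mx.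
- by rewrite PC /P -(mulmxA _ G) (mulmxA G) GH mul1mx.
- by rewrite CP !trmx_mul trmxK KT mulmxA.
- by rewrite PC !trmx_mul trmxK HT mulmxA.
Qed.

Lemma is_moore_penrose_mpinv m n (C : 'M[R]_(m, n)) :
  is_moore_penrose C (mpinv C).
Proof. exact: (xgetPex 0 (moore_penrose_exists C)). Qed.

Lemma moore_penrose_inj m n (C : 'M[R]_(m, n)) P Q :
  is_moore_penrose C P -> is_moore_penrose C Q -> P = Q.
Proof.
move=> [p1 p2 p3 p4] [q1 q2 q3 q4].
have e1 : C *m P = C *m Q.
  have -> : C *m P = (C *m Q) *m (C *m P) by rewrite mulmxA q1.
  by rewrite -[in LHS]p3 -[in LHS]q3 -trmx_mul mulmxA p1 q3.
have e2 : P *m C = Q *m C.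
  have -> : P *m C = (P *m C) *m (Q *m C) by rewrite -mulmxA (mulmxA C) q1.
  by rewrite -[in LHS]p4 -[in LHS]q4 -trmx_mul -mulmxA (mulmxA C) p1 q4.
by rewrite -p2 e2 -mulmxA e1 mulmxA q2.
Qed.

Lemma mpinv_unique m n (C : 'M[R]_(m, n)) P : is_moore_penrose C P -> mpinv C = P.
Proof. by move=> h; apply: moore_penrose_inj h; apply: is_moore_penrose_mpinv. Qed.

End Definitions.

(* Main.v *)
Require Import Defs.
From mathcomp Require Import lra topology normedtype derive.

Set Implicit Arguments.
Unset Strict Implicit.
Unset Printing Implicit Defensive.

Import Order.TTheory GRing.Theory Num.Theory.
Import numFieldNormedType.Exports.

Local Open Scope classical_set_scope.
Local Open Scope ring_scope.

(** The absolute value is piecewise linear with slopes in [-1, 1]: for each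
    coordinate, |x_i| - |z_i| is a multiple of x_i - z_i by a factor in
    [-1, 1].  Hence, when z is a solution, the residual of x is linear in the
    error,
      M (A x - B |x| - b) = (M A + M B D) (x - z),
    for some D in the unit box depending on x.  The matrix on the right has
    full column rank, so its pseudoinverse is a left inverse, and the error
    is this pseudoinverse applied to the residual; the induced norm bounds it.

    What remains is analytic: a supremum defines the induced norm, so it bounds
    the quotients Nn (C y) / Nm y only once these are known to be bounded, and
    the maximum over D has to be attained.  Both facts come from the
    extreme value theorem applied ([norm_ratio_max]) to the quotient
    Nn (P t y) / Nm y as a function of the pair (t, y), where t ranges over a
    compact set and y over the unit sphere of the max norm; by homogeneity
    the sphere stands for all nonzero y.  In this way the continuity of the
    induced norm itself never has to be discussed.  The quotient is continuous
    because every vector norm is Lipschitz in the coordinates, and because, on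
    matrices of full column rank, the pseudoinverse of C is
    (C^T C)^-1 C^T, whose entries are rational functions of those of C. *)

(** * Vector norms *)

Section VectorNorm.
Variables (R : realType) (n : nat) (N : 'cV[R]_n -> R).
Hypothesis hN : vector_norm N.

Lemma vector_norm0 : N 0 = 0.
Proof. by case: hN => _ NZ _; rewrite -(scale0r 0) NZ normr0 mul0r. Qed.

Lemma vector_normN x : N (- x) = N x.
Proof. by case: hN => _ NZ _; rewrite -scaleN1r NZ normrN1 mul1r. Qed.

Lemma vector_norm_ge0 x : 0 <= N x.
Proof.
case: hN => _ _ ND; have := ND x (- x).
by rewrite subrr vector_norm0 vector_normN -mulr2n pmulrn_lge0.
Qed.

Lemma vector_norm_gt0 x : x != 0 -> 0 < N x.
Proof.
case: hN => N0 _ _ x0; rewrite lt_neqAle vector_norm_ge0 andbT eq_sym.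
by apply: contra x0 => /eqP/N0 ->.
Qed.

Lemma vector_norm_le_coord x :
  N x <= \sum_i `|x i 0| * N (delta_mx i 0).
Proof.
case: hN => _ NZ ND; rewrite {1}[x]matrix_sum_delta.
under eq_bigr do rewrite big_ord1.
apply: (big_ind2 (fun u a => N u <= a)) => [|u a v c ua vc|i _].
- by rewrite vector_norm0.
- exact: le_trans (ND _ _) (lerD ua vc).
- by rewrite NZ.
Qed.

(** Any norm is Lipschitz in the coordinates, hence continuous for the product
    topology. *)
Lemma vector_norm_dist x y :
  `|N x - N y| <= \sum_i `|x i 0 - y i 0| * N (delta_mx i 0).
Proof.
have [_ _ ND] := hN.
apply: le_trans (_ : N (x - y) <= _); last first.
  apply: le_trans (vector_norm_le_coord _) _.
  by apply: ler_sum => i _; rewrite !mxE.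
rewrite ler_norml.
have := ND (y - x) x; rewrite subrK -opprB vector_normN => hyx.
by have := ND (x - y) y; rewrite subrK => hxy; lra.
Qed.

End VectorNorm.

(** * Continuity of matrix-valued functions *)

Section EntrywiseContinuity.
Variables (R : realType) (T : topologicalType) (t : T).

(** Stated through the entries, so that matrix operations reduce to the real
    sums and products that define them. *)
Definition entries_continuous p q (F : T -> 'M[R]_(p, q)) : Prop :=
  forall i j, (F s i j) @[s --> t] --> F t i j.

Lemma cvg_sumr (I : Type) (r : seq I) (P : pred I) (f : I -> T -> R) :
  (forall i, P i -> f i s @[s --> t] --> f i t) ->
  (\sum_(i <- r | P i) f i s) @[s --> t] --> \sum_(i <- r | P i) f i t.
Proof. by apply: cvg_big => // x; exact: add_continuous. Qed.

Lemma cvg_prodr (I : Type) (r : seq I) (P : pred I) (f : I -> T -> R) :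
  (forall i, P i -> f i s @[s --> t] --> f i t) ->
  (\prod_(i <- r | P i) f i s) @[s --> t] --> \prod_(i <- r | P i) f i t.
Proof. by apply: cvg_big => // x; exact: mul_continuous. Qed.

Lemma entries_continuous_cst p q (C : 'M[R]_(p, q)) :
  entries_continuous (fun=> C).
Proof. by move=> i j; exact: cvg_cst. Qed.

Lemma entries_continuous_tr p q (F : T -> 'M[R]_(p, q)) :
  entries_continuous F -> entries_continuous (fun s => (F s)^T).
Proof.
move=> cF i j; rewrite mxE; under eq_cvg do rewrite mxE; exact: cF.
Qed.

Lemma entries_continuousD p q (F G : T -> 'M[R]_(p, q)) :
  entries_continuous F -> entries_continuous G ->
  entries_continuous (fun s => F s + G s).
Proof.
move=> cF cG i j; rewrite mxE; under eq_cvg do rewrite mxE.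
exact: cvgD (cF i j) (cG i j).
Qed.

Lemma entries_continuousM p q r (F : T -> 'M[R]_(p, q))
    (G : T -> 'M[R]_(q, r)) :
  entries_continuous F -> entries_continuous G ->
  entries_continuous (fun s => F s *m G s).
Proof.
move=> cF cG i j; rewrite mxE; under eq_cvg do rewrite mxE.
by apply: cvg_sumr => k _; exact: cvgM (cF i k) (cG k j).
Qed.

Lemma entries_continuous_det p (F : T -> 'M[R]_p) :
  entries_continuous F -> (\det (F s)) @[s --> t] --> \det (F t).
Proof.
move=> cF; apply: cvg_sumr => sg _; apply: cvgM; first exact: cvg_cst.
by apply: cvg_prodr => k _; exact: cF.
Qed.

Lemma entries_continuous_adj p (F : T -> 'M[R]_p) :
  entries_continuous F -> entries_continuous (fun s => \adj (F s)).
Proof.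
move=> cF i j; rewrite mxE; under eq_cvg do rewrite mxE.
apply: cvgM; first exact: cvg_cst.
apply: entries_continuous_det => k l.
by rewrite !mxE; under eq_cvg do rewrite !mxE; exact: cF.
Qed.

(** Near t the determinant stays nonzero, so that [invmx] is given by Cramer's
    formula there; elsewhere [invmx] is the identity function. *)
Lemma entries_continuous_inv p (F : T -> 'M[R]_p) :
  F t \in unitmx -> entries_continuous F ->
  entries_continuous (fun s => invmx (F s)).
Proof.
move=> uF cF i j.
have cdet := entries_continuous_det cF.
have d0 : \det (F t) != 0 by rewrite -unitfE -unitmxE.
have cG : ((\det (F s))^-1 * (\adj (F s)) i j) @[s --> t]
    --> (\det (F t))^-1 * (\adj (F t)) i j.
  by apply: cvgM; [exact: cvgV | exact: entries_continuous_adj].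
have invE s : \det (F s) != 0 ->
    invmx (F s) i j = (\det (F s))^-1 * (\adj (F s)) i j.
  by move=> ds; rewrite /invmx unitmxE unitfE ds mxE.
rewrite invE //; apply: cvg_trans cG.
apply: near_eq_cvg; near=> s; rewrite invE //.
near: s; exact: (cvgr_neq0 (F := nbhs t) _ cdet d0).
Unshelve. all: by end_near. Qed.

(** The Lipschitz bound tends to 0 along with the coordinate differences. *)
Lemma vector_norm_continuous p (N : 'cV[R]_p -> R) (F : T -> 'cV[R]_p) :
  vector_norm N -> entries_continuous F -> N (F s) @[s --> t] --> N (F t).
Proof.
move=> hN cF.
have c0 : (\sum_i `|F t i 0 - F s i 0| * N (delta_mx i 0)) @[s --> t] --> 0.
  rewrite [X in _ --> X](_ : 0 =
      \sum_i `|F t i 0 - F t i 0| * N (delta_mx i 0)); last first.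
    by rewrite big1 // => i _; rewrite subrr normr0 mul0r.
  apply: cvg_sumr => i _; apply: cvgM; last exact: cvg_cst.
  by apply: cvg_norm; apply: cvgB; [exact: cvg_cst | exact: cF].
apply/cvgrPdist_lt => e e0.
move/cvgrPdist_lt : c0 => /(_ e e0); apply: filterS => s.
rewrite sub0r normrN => hs; apply: le_lt_trans (vector_norm_dist hN _ _) _.
exact: le_lt_trans (ler_norm _) hs.
Qed.

End EntrywiseContinuity.

Lemma entries_continuous_diag_mx (R : realType) p (d : 'rV[R]_p) :
  entries_continuous d (@diag_mx R p).
Proof.
move=> i j; rewrite mxE.
have -> : (fun s : 'rV[R]_p => diag_mx s i j) = (fun s => s 0 i *+ (i == j)).
  by apply/funext => s; rewrite mxE.
have ci := @coord_continuous R 1 p 0 i d.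
exact: cvgMn ci.
Qed.

(** * Induced norms and their maxima over compact families *)

Section InducedNorm.
Variables (R : realType) (m n : nat).
Variables (Nn : 'cV[R]_n -> R) (Nm : 'cV[R]_m -> R).
Hypotheses (hNn : vector_norm Nn) (hNm : vector_norm Nm).

Lemma unit_sphere_compact : compact [set y : 'rV[R]_m | `|y| = 1].
Proof.
apply: bounded_closed_compact.
  exists 1; split; first exact: real1.
  by move=> M M1 y /= ->; exact: ltW.
apply: (closed_comp (f := fun y : 'rV[R]_m => `|y|) (D := [set 1])).
  by move=> y _; exact: norm_continuous.
exact: closed_eq.
Qed.

(** Homogeneity of degree 0 is what allows [y] to be restricted to a sphere. *)
Lemma norm_ratioZ (C : 'M[R]_(n, m)) (y : 'cV[R]_m) (a : R) : a != 0 ->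
  Nn (C *m (a *: y)) / Nm (a *: y) = Nn (C *m y) / Nm y.
Proof.
case: hNn => _ NnZ _; case: hNm => _ NmZ _ a0.
by rewrite -scalemxAr NnZ NmZ invfM mulrACA divff ?mul1r// normr_eq0.
Qed.

(** Maximizing over the parameter and the vector at once: the maximum at
    [(t0, y0)] bounds the quotients of every [P t] and is a quotient of
    [P t0]. *)
Lemma norm_ratio_max (T : topologicalType) (K : set T)
    (P : T -> 'M[R]_(n, m)) :
  (0 < m)%N -> K !=set0 -> compact K ->
  (forall t, K t -> entries_continuous t P) ->
  exists t0 y0, [/\ K t0, y0 != 0
    & forall t y, K t -> y != 0 ->
        Nn (P t *m y) / Nm y <= Nn (P t0 *m y0) / Nm y0].
Proof.
move=> m0 [k Kk] cK cP.
pose S := [set y : 'rV[R]_m | `|y| = 1].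
pose f (ty : T * 'rV[R]_m) := Nn (P ty.1 *m ty.2^T) / Nm ty.2^T.
have nrmS (y : 'rV[R]_m) : y != 0 -> S (`|y|^-1 *: y).
  move=> y0; have ny0 : `|y| != 0 by rewrite normr_eq0.
  by rewrite /S /= normrZ normfV normr_id mulVf.
have S0 : S !=set0.
  pose e : 'rV[R]_m := const_mx 1.
  exists (`|e|^-1 *: e); apply: nrmS.
  apply/eqP => /rowP /(_ (Ordinal m0)); rewrite !mxE => /eqP.
  by rewrite oner_eq0.
have neS (y : 'rV[R]_m) : S y -> y^T != 0.
  rewrite /S /= => y1; apply/eqP => yT; move: y1.
  by rewrite -(trmxK y) yT trmx0 normr0 => /eqP; rewrite eq_sym oner_eq0.
have cf : {within K `*` S, continuous f}.
  apply: continuous_in_subspaceT => -[t y]; rewrite inE => -[/= Kt Sy].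
  have cy : entries_continuous (t, y) (fun ty : T * 'rV[R]_m => ty.2^T).
    apply: entries_continuous_tr => i j.
    apply: (cvg_comp (fun ty : T * 'rV[R]_m => ty.2)
              (fun M : 'rV[R]_m => M i j) cvg_snd).
    exact: coord_continuous.
  have cPt : entries_continuous (t, y) (fun ty : T * 'rV[R]_m => P ty.1).
    move=> i j.
    apply: (cvg_comp (fun ty : T * 'rV[R]_m => ty.1)
              (fun s => P s i j) cvg_fst).
    exact: cP.
  apply: cvgM.
    by apply: vector_norm_continuous => //; exact: entries_continuousM.
  apply: cvgV; first by rewrite gt_eqF // vector_norm_gt0 //; exact: neS.
  exact: vector_norm_continuous.
have KS0 : (K `*` S) !=set0 by case: S0 => y Sy; exists (k, y).
have [[t0 y0]] :=
  compact_EVT_max KS0 (compact_setX cK unit_sphere_compact) cf.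
rewrite inE => -[/= Kt0 Sy0] fmax.
exists t0, y0^T; split=> // [|t y Kt yn0]; first exact: neS.
have yT0 : y^T != 0.
  by apply: contra yn0 => /eqP yT; rewrite -(trmxK y) yT trmx0.
have := fmax (t, `|y^T|^-1 *: y^T).
rewrite inE => /(_ (conj Kt (nrmS _ yT0))).
by rewrite /f /= linearZ /= trmxK norm_ratioZ // invr_eq0 normr_eq0.
Qed.

(** A supremum bounds its set only if the set is bounded; here the bound is the
    maximum that [norm_ratio_max] provides for a constant family. *)
Lemma norm_ratio_le_induced (C : 'M[R]_(n, m)) (y : 'cV[R]_m) : y != 0 ->
  Nn (C *m y) / Nm y <= induced_norm Nn Nm C.
Proof.
move=> yn0; apply: ub_le_sup; last by exists y.
have m0 : (0 < m)%N.
  by case: m y yn0 => // y; rewrite (flatmx0 y) eqxx.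
have [] := @norm_ratio_max R [set 0] (fun=> C) m0.
- by exists 0.
- exact: compact_set1.
- by move=> t _; exact: entries_continuous_cst.
move=> t0 [y0 [_ _ h]]; exists (Nn (C *m y0) / Nm y0) => _ [z /= z0 <-].
exact: (h 0).
Qed.

Lemma vector_norm_mulmx_le (C : 'M[R]_(n, m)) (y : 'cV[R]_m) :
  Nn (C *m y) <= induced_norm Nn Nm C * Nm y.
Proof.
have [->|y0] := eqVneq y 0.
  by rewrite mulmx0 !vector_norm0 // mulr0.
by rewrite -ler_pdivrMr ?vector_norm_gt0 // norm_ratio_le_induced.
Qed.

(** A maximizing pair [(t0, y0)] of the quotient gives a maximizer [t0] of the
    induced norm: the latter is at least the quotient at [(t0, y0)], which is
    an upper bound of all quotients of all [P t]. *)
Lemma induced_norm_max (T : topologicalType) (K : set T)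
    (P : T -> 'M[R]_(n, m)) :
  K !=set0 -> compact K -> (forall t, K t -> entries_continuous t P) ->
  exists2 t0, K t0
    & forall t, K t -> induced_norm Nn Nm (P t) <= induced_norm Nn Nm (P t0).
Proof.
move=> K0 cK cP; have [m0|m0] := posnP m.
  (* There is no nonzero vector, so all the induced norms are sup set0. *)
  case: K0 => t0 Kt0; exists t0 => // t Kt; rewrite /induced_norm.
  rewrite le_eqVlt; apply/orP; left; apply/eqP; congr sup.
  have y0 (y : 'cV[R]_m) : y = 0.
    by apply/matrixP => -[i im]; exfalso; move: im; rewrite m0.
  by apply/seteqP; split=> z [y /=]; rewrite (y0 y) eqxx.
have [t0 [y0 [Kt0 y0n0 h]]] := norm_ratio_max m0 K0 cK cP.
exists t0 => // t Kt; apply: le_trans (norm_ratio_le_induced (P t0) y0n0).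
apply: sup_le_ub; first by exists (Nn (P t *m y0) / Nm y0), y0.
by move=> _ [y /= yn0 <-]; exact: h.
Qed.

End InducedNorm.

(** * Pseudoinverses of matrices of full column rank *)

Section FullColumnRank.
Variable R : realType.

Lemma gram_unitmx m n (C : 'M[R]_(m, n)) :
  full_column_rank C -> C^T *m C \in unitmx.
Proof.
move=> rC; rewrite -{2}(trmxK C); apply: row_gram_unit.
by rewrite /row_free mxrank_tr rC.
Qed.

(** Besides giving the left inverse property, this formula exhibits the
    pseudoinverse as a continuous function of C as long as C has full column
    rank; across a drop of rank the pseudoinverse is discontinuous. *)
Lemma mpinv_full_column_rank m n (C : 'M[R]_(m, n)) :
  full_column_rank C -> mpinv C = invmx (C^T *m C) *m C^T.
Proof.
move=> /gram_unitmx uC; apply: mpinv_unique.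
have PC : invmx (C^T *m C) *m C^T *m C = 1%:M by rewrite -mulmxA mulVmx.
split.
- by rewrite -mulmxA PC mulmx1.
- by rewrite PC mul1mx.
- by rewrite !trmx_mul trmxK trmx_inv trmx_mul trmxK mulmxA.
- by rewrite PC trmx1.
Qed.

Lemma mpinvK m n (C : 'M[R]_(m, n)) :
  full_column_rank C -> mpinv C *m C = 1%:M.
Proof.
move=> rC; rewrite mpinv_full_column_rank // -mulmxA mulVmx //.
exact: gram_unitmx.
Qed.

End FullColumnRank.

(** * The unit box and differences of absolute values *)

Section UnitBox.
Variable R : realType.

(** The diagonals of the matrices of the unit box; as row vectors they form a
    product of segments, whence compactness. *)
Definition diag_box n : set 'rV[R]_n :=
  [set d | forall i, d ord0 i \in `[-1, 1]].

Lemma diag_box_compact n : compact (@diag_box n).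
Proof.
apply: (@rV_compact R n (fun=> `[-1, 1]%classic)).
by move=> _; exact: segment_compact.
Qed.

Lemma unit_boxE n : @unit_box R n = [set diag_mx d | d in @diag_box n].
Proof.
apply/seteqP; split=> [D hD|_ [d hd <-] i j].
  exists (\row_i D i i) => [i|].
    by have := hD i i; rewrite !mxE eqxx in_itv.
  apply/matrixP => i j; rewrite !mxE; have := hD i j; rewrite mxE.
  case: eqVneq => [->|_] /=; first by rewrite mulr1n.
  by rewrite oppr0 -eq_le => /eqP <-; rewrite mulr0n.
rewrite !mxE; case: eqVneq => [_|_] /=.
  by have := hd i; rewrite in_itv mulr1n.
by rewrite mulr0n oppr0 lexx.
Qed.

(** Up to sign, [d] is the slope of a chord of the graph of the absolute value,
    bounded by 1 through the reverse triangle inequality. *)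
Lemma norm_diff_slope (a c : R) :
  exists2 d : R, d \in `[-1, 1] & `|c| - `|a| = d * (a - c).
Proof.
(* Division by zero gives slope 0 when a = c, which is admissible. *)
exists ((`|c| - `|a|) / (a - c)).
  rewrite in_itv /= -ler_norml normrM normfV.
  have [->|ac] := eqVneq a c; first by rewrite subrr normr0 mul0r.
  rewrite ler_pdivrMr ?normr_gt0 ?subr_eq0 // mul1r distrC.
  exact: ler_dist_dist.
have [->|ac] := eqVneq a c; first by rewrite !subrr mulr0.
by rewrite divfK // subr_eq0.
Qed.

(** The difference is taken as |y| - |x| against x - y, so that the sign of the
    term - B |x| is absorbed in D, the box being symmetric. *)
Lemma abs_mx_diff n (x y : 'cV[R]_n) :
  exists2 D, unit_box D & abs_mx y - abs_mx x = D *m (x - y).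
Proof.
have /choice[d dP] i : exists d : R,
    d \in `[-1, 1] /\ `|y i 0| - `|x i 0| = d * (x i 0 - y i 0).
  by have [d] := norm_diff_slope (x i 0) (y i 0); exists d.
exists (diag_mx (\row_i d i)).
  by rewrite unit_boxE; exists (\row_i d i) => // i; rewrite mxE; case: (dP i).
by apply/colP => i; rewrite mul_diag_mx !mxE; case: (dP i).
Qed.

End UnitBox.

(** * The error bound *)

Theorem theorem3p9 (R : realType) (m n : nat)
    (Nn : 'cV[R]_n -> R) (Nm : 'cV[R]_m -> R)
    (A B : 'M[R]_(m, n)) (b : 'cV[R]_m) :
  vector_norm Nn -> vector_norm Nm ->
  gave_sol A B b !=set0 ->
  (forall D : 'M[R]_n, unit_box D -> full_column_rank (A + B *m D)) ->
  forall xs : 'cV[R]_n, gave_sol A B b xs ->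
  forall M : 'M[R]_m, M \in unitmx ->
  exists2 mu : R,
    is_max [set induced_norm Nn Nm (mpinv (M *m A + M *m B *m D))
           | D in @unit_box R n] mu
  & forall x : 'cV[R]_n,
      Nn (x - xs) <= mu * Nm (M *m (A *m x - B *m abs_mx x - b)).
Proof.
move=> hNn hNm _ hrank xs hxs M uM.
pose C D := M *m A + M *m B *m D.
have CE D : C D = M *m (A + B *m D) by rewrite mulmxDr mulmxA.
have rC D : unit_box D -> full_column_rank (C D).
  by move=> /hrank; rewrite /full_column_rank CE eqmxMfull // row_full_unit.
(* The closed formula replaces [mpinv] in the extreme value argument; the two
   agree on the box, where the rank is full. *)
pose P (d : 'rV[R]_n) :=
  invmx ((C (diag_mx d))^T *m C (diag_mx d)) *m (C (diag_mx d))^T.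
have PE d : diag_box d -> P d = mpinv (C (diag_mx d)).
  move=> hd; rewrite mpinv_full_column_rank //; apply: rC.
  by rewrite unit_boxE; exists d.
have cP d : diag_box d -> entries_continuous d P.
  move=> hd.
  have cC : entries_continuous d (fun s => C (diag_mx s)).
    apply: entries_continuousD; first exact: entries_continuous_cst.
    apply: entries_continuousM; first exact: entries_continuous_cst.
    exact: entries_continuous_diag_mx.
  have cCT := entries_continuous_tr cC.
  apply: entries_continuousM => //; apply: entries_continuous_inv.
    by apply/gram_unitmx/rC; rewrite unit_boxE; exists d.
  exact: entries_continuousM.
have box0 : @diag_box R n !=set0.
  by exists 0 => i; rewrite mxE in_itv /= oppr_le0 ler01.
have [d0 hd0 dmax] := induced_norm_max hNn hNm box0 (@diag_box_compact R n) cP.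
have maxP D : unit_box D ->
    induced_norm Nn Nm (mpinv (C D)) <= induced_norm Nn Nm (P d0).
  by rewrite unit_boxE => -[d hd <-]; rewrite -PE //; exact: dmax.
exists (induced_norm Nn Nm (P d0)).
  split; last by move=> _ [D hD <-]; exact: maxP.
  by exists (diag_mx d0); [rewrite unit_boxE; exists d0 | rewrite PE].
move=> x; have [D hD absE] := abs_mx_diff x xs.
have resE : M *m (A *m x - B *m abs_mx x - b) = C D *m (x - xs).
  rewrite CE -mulmxA; congr (M *m _); rewrite -hxs mulmxDl -mulmxA -absE.
  by rewrite !mulmxBr opprB addrACA [RHS]addrACA [X in _ + X = _]addrC.
rewrite resE.
have {1}-> : x - xs = mpinv (C D) *m (C D *m (x - xs)).
  by rewrite mulmxA mpinvK ?mul1mx //; exact: rC.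
apply: le_trans (vector_norm_mulmx_le hNn hNm _ _) _.
by rewrite ler_wpM2r ?vector_norm_ge0 // maxP.
Qed.
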